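(* Let $\{\lambda^\nu\}\subset(0,\infty)$ and $\{\beta^\nu\}\subset(0,1)$ be sequences such that $\lambda^\nu\searrow0$ and $\limsup_{\nu\to\infty}\beta^\nu<1$. Consider a sequence $\{x^\nu\}\subset\mathbb{R}^n$ such that $\operatorname{dist}(-\nabla s_{\lambda^\nu,\beta^\nu}(x^\nu),N_C(x^\nu))\searrow0$, and suppose that $\{x^\nu\}\to x$, where $x$ satisfies $F_i(x)\in D$ for all $i\in\{1,\dots,p\}$, and BCCQ holds at $x$. Let $\mathbf{y}^\nu=(y_1^\nu,\dots,y_p^\nu)$ with $y_i^\nu=\frac1{\lambda^\nu}R_{\beta^\nu}(F_i(x^\nu))$. Then the sequence of multipliers converges, $\{\mathbf{y}^\nu\}\to\mathbf{y}=(y_1,\dots,y_p)$, and every limit pair $(x,\mathbf{y})$ is a C-stationary primal-dual pair of the problem of minimizing $f(x)$ over $x\in C$ subject to $G(x)\ge0$, $H(x)\ge0$, $\langle G(x),H(x)\rangle=0$, i.e., $$0\in\nabla f(x)+\sum_{i=1}^pJF_i(x)^\top y_i+N_C(x)\quad\text{with}\quad y_i\in N_D^{\rm C}(F_i(x))\ \ \forall i\in\{1,\dots,p\}.$$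
   Context: Setting: $f:\mathbb{R}^n\to\mathbb{R}$ and $G,H:\mathbb{R}^n\to\mathbb{R}^p$ are smooth, $C\subseteq\mathbb{R}^n$ is nonempty, closed and convex; the problem is to minimize $f(x)$ over $x\in C$ subject to $G(x)\ge0$, $H(x)\ge0$, $\langle G(x),H(x)\rangle=0$, and its solution set is assumed nonempty. $F_i=(G_i,H_i):\mathbb{R}^n\to\mathbb{R}^2$ with Jacobian $JF_i(x)\in\mathbb{R}^{2\times n}$ (rows $\nabla G_i(x)^\top,\nabla H_i(x)^\top$). $D=\{z\in\mathbb{R}^2:z_1,z_2\ge0,\ z_1z_2=0\}$; $x$ is feasible iff $x\in C$ and $F_i(x)\in D$ for all $i$. Cones at $z\in D$: $N_D(z)=\{0\}\times\mathbb{R}$ if $z_1>0$; $\mathbb{R}\times\{0\}$ if $z_2>0$; $N_D((0,0))=\{y:y_1\le0,y_2\le0\}\cup D$. The cone $N_D^{\rm C}(z)=N_D(z)$ if $z\ne(0,0)$ and $N_D^{\rm C}((0,0))=N_D((0,0))\cup\mathbb{R}_+^2$. $N_C(x)$ is the normal cone of the convex set $C$ at $x$ (empty if $x\notin C$, with distance to the empty set equal to $+\infty$). For $\beta\in(0,1)$, $$r_\beta(z)=\begin{cases}\frac{1}{2(1-\beta)}\|z\|^2&\text{if }z_1\le0,z_2\le0\\ \frac{(z_1+z_2)^2}{2\beta(2-\beta)}-\frac{\|z\|^2}{2\beta}&\text{if }(1-\beta)z_1\le z_2\le\frac{z_1}{1-\beta}\\ \frac{1}{2(1-\beta)}\min\{z_1,z_2\}^2&\text{otherwise,}\end{cases}$$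 which is continuously differentiable, and $R_\beta=\nabla r_\beta$. Moreover $s_{\lambda,\beta}(x)=f(x)+\frac1\lambda\sum_{i=1}^pr_\beta(F_i(x))$. Well-behaved: $F_i$ is a well-behaved complementarity constraint if there is $\xi>0$ such that for every $x\in\mathbb{R}^n$, $F_i(x)\notin\{z:\|z\|\le\xi,\ z_1>0,\ z_2>0\}$. Let $\mathcal W\subseteq\{1,\dots,p\}$ be the set of indices $i$ with $F_i$ well-behaved. BCCQ (basic Clarke constraint qualification) holds at a feasible point $x$ if whenever $y_i=(y_i^G,y_i^H)\in\mathbb{R}^2$, $i=1,\dots,p$, satisfy $y_i\in N_D(F_i(x))$ for $i\in\mathcal W$, $y_i\in N_D^{\rm C}(F_i(x))$ for $i\notin\mathcal W$, and $0\in\sum_{i=1}^pJF_i(x)^\top y_i+N_C(x)$, then for each $i\in\{1,\dots,p\}$: ($G_i$ is constant or $y_i^G=0$) and ($H_i$ is constant or $y_i^H=0$).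
   Formalization: The multiplier sequence need not converge as a whole (it can oscillate when the β^ν alternate), so ''converges'' is replaced by: every subsequence of {y^ν} has a convergent further subsequence, and every subsequential limit y gives a C-stationary pair (x,y). *)

(* Defs.v *)
From HB Require Import structures.
From mathcomp Require Import all_boot all_order all_algebra.
From mathcomp Require Import all_classical all_reals all_analysis.

Set Implicit Arguments.
Unset Strict Implicit.
Unset Printing Implicit Defensive.

Import Order.TTheory GRing.Theory Num.Theory.
Import numFieldNormedType.Exports.

Local Open Scope classical_set_scope.
Local Open Scope ring_scope.

(* Vectors of R^n are rows 'rV[R]_n.  The norm `|_| that the library puts on
   them is the max norm, hence the Euclidean structure below. *)

Section Euclidean.
Context {R : realType} {n : nat}.
Implicit Types (x y v : 'rV[R]_n) (A C : set 'rV[R]_n) (f : 'rV[R]_n -> R).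

Definition dotv x y : R := \sum_(j < n) x 0 j * y 0 j.

Definition enorm x : R := Num.sqrt (dotv x x).

(* In extended reals, so that the distance to the empty set is +oo. *)
Definition dist x A : \bar R := ereal_inf [set (enorm (x - y))%:E | y in A].

Definition grad f x : 'rV[R]_n := \row_(j < n) 'D_(delta_mx 0 j) f x.

Definition smooth f : Prop :=
  (forall x, differentiable f x) /\ continuous (grad f).

Definition normal_cone C x : set 'rV[R]_n :=
  [set v : 'rV[R]_n | C x /\ forall y, C y -> dotv v (y - x) <= 0].

Definition is_constant f : Prop := exists c : R, forall x, f x = c.

End Euclidean.

Section Complementarity.
Context {R : realType}.
Implicit Types (z : 'rV[R]_2) (b : R).

Definition D : set 'rV[R]_2 :=
  [set z : 'rV[R]_2 | 0 <= z 0 0 /\ 0 <= z 0 1 /\ z 0 0 * z 0 1 = 0].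

(* Both cones are empty outside D. *)
Definition N_D z : set 'rV[R]_2 :=
  [set y : 'rV[R]_2 | D z /\
     if 0 < z 0 0 then y 0 0 = 0
     else if 0 < z 0 1 then y 0 1 = 0
     else (y 0 0 <= 0 /\ y 0 1 <= 0) \/ D y].

Definition N_DC z : set 'rV[R]_2 :=
  if z == 0 then N_D 0 `|` [set y : 'rV[R]_2 | 0 <= y 0 0 /\ 0 <= y 0 1] else N_D z.

Definition r_ b z : R :=
  if (z 0 0 <= 0) && (z 0 1 <= 0) then
    (2 * (1 - b))^-1 * enorm z ^+ 2
  else if (1 - b) * z 0 0 <= z 0 1 <= z 0 0 / (1 - b) then
    (z 0 0 + z 0 1) ^+ 2 / (2 * b * (2 - b)) - enorm z ^+ 2 / (2 * b)
  else
    (2 * (1 - b))^-1 * Num.min (z 0 0) (z 0 1) ^+ 2.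

Definition R_ b : 'rV[R]_2 -> 'rV[R]_2 := grad (r_ b).

End Complementarity.

Section Problem.
Context {R : realType} {n p : nat}.
Variables (f : 'rV[R]_n -> R) (G H : 'rV[R]_n -> 'rV[R]_p) (C : set 'rV[R]_n).
Implicit Types (i : 'I_p) (x : 'rV[R]_n) (y : 'M[R]_(p, 2)).

Definition component (K : 'rV[R]_n -> 'rV[R]_p) i : 'rV[R]_n -> R :=
  fun x => K x 0 i.

Definition F i x : 'rV[R]_2 :=
  \row_(k < 2) (if k == 0 then G x 0 i else H x 0 i).

(* The Jacobian of F i, with rows grad G_i and grad H_i.  For a row vector
   v : 'rV_2, the vector JF_i(x)^T v is the row v *m JF i x. *)
Definition JF i x : 'M[R]_(2, n) :=
  col_mx (grad (component G i) x) (grad (component H i) x).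

Definition feasible x : Prop :=
  [/\ C x, forall i, 0 <= G x 0 i, forall i, 0 <= H x 0 i
    & dotv (G x) (H x) = 0].

Definition solution x : Prop :=
  feasible x /\ forall x', feasible x' -> f x <= f x'.

Definition s_ (lambda b : R) x : R :=
  f x + lambda^-1 * \sum_(i < p) r_ b (F i x).

Definition well_behaved i : Prop :=
  exists2 xi : R, 0 < xi &
    forall x, ~ [/\ enorm (F i x) <= xi, 0 < F i x 0 0 & 0 < F i x 0 1].

(* A multiplier (y_1, ..., y_p) in (R^2)^p is the matrix y with rows y_i;
   y_i^G = y i 0 and y_i^H = y i 1. *)
Definition BCCQ x : Prop :=
  forall y,
    (forall i, well_behaved i -> N_D (F i x) (row i y)) ->
    (forall i, ~ well_behaved i -> N_DC (F i x) (row i y)) ->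
    (exists2 v, normal_cone C x v &
       0 = \sum_(i < p) row i y *m JF i x + v) ->
  forall i, (is_constant (component G i) \/ y i 0 = 0) /\
            (is_constant (component H i) \/ y i 1 = 0).

Definition multiplier (lambda b : R) x : 'M[R]_(p, 2) :=
  \matrix_(i < p) (lambda^-1 *: R_ b (F i x)).

Definition C_stationary x y : Prop :=
  (exists2 v, normal_cone C x v &
     0 = grad f x + \sum_(i < p) row i y *m JF i x + v) /\
  forall i, N_DC (F i x) (row i y).

End Problem.

(* Strictly increasing index maps, i.e. the subsequences of a sequence. *)
Definition extraction (phi : nat -> nat) : Prop :=
  forall k l, (k < l)%N -> (phi k < phi l)%N.

(* Main.v *)
(* With c = 1 - beta, the function r_beta is given by four quadratic forms on
   four closed convex cones covering the plane, and the forms agree to first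
   order where the cones meet; this yields the gradient R_beta cone by cone.
   Reading off the signs, the multipliers eventually lie in the limiting cones
   N_D^C(F_i(x)) (in N_D(F_i(x)) for well-behaved i), and their entry for a
   constant G_i or H_i eventually vanishes.  These conditions are closed and
   conic, and so is v \in N_C(x) as a relation in (x, v); hence rescaled
   multipliers tau_k y^k with limit y, tau_k -> t, satisfy
   0 \in t grad f(x) + sum_i JF_i(x)^T y_i + N_C(x).  For t = 1 this is
   C-stationarity; for t = 0, reached by normalizing an unbounded sequence of
   multipliers, it contradicts BCCQ. *)
Require Import Defs.
From mathcomp Require Import all_boot all_order all_algebra.
From mathcomp Require Import all_classical all_reals all_analysis.
From mathcomp Require Import ring lra.

Set Implicit Arguments.
Unset Strict Implicit.
Unset Printing Implicit Defensive.

Import Order.TTheory GRing.Theory Num.Theory.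
Import numFieldNormedType.Exports.

Local Open Scope classical_set_scope.
Local Open Scope ring_scope.

(* Being closed, the pieces that do not contain x play no role near x. *)
Lemma is_derive_glue (R : numFieldType) (V W : normedModType R) (I : finType)
  (k : V -> W) (q : I -> V -> W) (P : I -> set V) (x v : V) (d : W) :
  (forall i, closed (P i)) ->
  (forall y, exists2 i, P i y & k y = q i y) ->
  (forall i, P i x -> k x = q i x /\ is_derive x v (q i) d) ->
  is_derive x v k d.
Proof.
move=> Pcl cover active.
suff kd : (fun h => h^-1 *: ((k \o shift x) (h *: v) - k x)) @ 0^' --> d.
  by apply: DeriveDef; [apply/cvg_ex; exists d | apply/cvg_lim].
apply/cvgrPdist_lt => e e0.
have near_active i : \forall h \near 0^', P i (h *: v + x) ->
    `|d - h^-1 *: ((q i \o shift x) (h *: v) - k x)| < e.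
  have [Pix|nPix] := pselect (P i x).
    have [kq [dq dqE]] := active i Pix.
    rewrite kq.
    have : (fun h => h^-1 *: ((q i \o shift x) (h *: v) - q i x)) @ 0^' --> d.
      by rewrite -dqE; exact: dq.
    move=> /cvgrPdist_lt /(_ e e0); apply: filterS => h hd _; exact: hd.
  have : \forall h \near (0:R)^', ~ P i (h *: v + x).
    have : \forall y \near x, ~ P i y.
      by apply: open_nbhs_nbhs; split => //; exact: closed_openC.
    have : (fun h : R => h *: v + x) @ 0^' --> x.
      rewrite -[X in _ --> X]add0r -(scale0r v); apply: cvgD;
        last exact: cvg_cst.
      by apply: cvgZ; [exact: nbhs_dnbhs|exact: cvg_cst].
    by move=> /[apply].
  by apply: filterS => h.
near=> h.
have near_all : forall i, P i (h *: v + x) ->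
    `|d - h^-1 *: ((q i \o shift x) (h *: v) - k x)| < e.
  by near: h; apply: filter_forall.
have [i Pi kq] := cover (h *: v + x).
by rewrite /= kq; exact: near_all.
Unshelve. all: by end_near. Qed.

(** * The quadratic forms that make up r_beta *)

Section Pieces.
Context {R : realType}.
Implicit Types (a b c : R) (i : bool * bool).

(* c stands for 1 - beta.  The index (true, true) is the first case of r_beta
   and (false, false) the second; the third splits into (true, false), where
   the minimum is z_2, and (false, true), where it is z_1. *)
Definition piece c i (z : R * R) : Prop :=
  match i with
  | (true, true) => z.1 <= 0 /\ z.2 <= 0
  | (false, false) => c * z.1 <= z.2 /\ c * z.2 <= z.1
  | (true, false) => 0 <= z.1 /\ z.2 <= c * z.1
  | (false, true) => 0 <= z.2 /\ z.1 <= c * z.2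
  end.

(** With beta = 1 - c one has beta (2 - beta) = 1 - c^2; the entry [(false, false)] is the second
    case of r_beta over the common denominator 2 (1 - c^2). *)
Definition piece_val c i (z : R * R) : R :=
  match i with
  | (true, true) => (z.1 ^+ 2 + z.2 ^+ 2) / (2 * c)
  | (false, false) =>
      (2 * z.1 * z.2 - c * z.1 ^+ 2 - c * z.2 ^+ 2) / (2 * (1 - c ^+ 2))
  | (true, false) => z.2 ^+ 2 / (2 * c)
  | (false, true) => z.1 ^+ 2 / (2 * c)
  end.

(** The numerators at [(false, false)] are the slacks of the two inequalities defining that piece,
    hence nonnegative on it. *)
Definition piece_grad c i (z : R * R) : R * R :=
  match i with
  | (true, true) => (z.1 / c, z.2 / c)
  | (false, false) =>
      ((z.2 - c * z.1) / (1 - c ^+ 2), (z.1 - c * z.2) / (1 - c ^+ 2))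
  | (true, false) => (0, z.2 / c)
  | (false, true) => (z.1 / c, 0)
  end.

Lemma piece_cover c z : 0 < c < 1 -> exists i, piece c i z.
Proof.
case: z => a b /andP[c0 c1].
have [a0|a0] := leP a 0; have [b0|b0] := leP b 0.
- by exists (true, true).
- by exists (false, true); split => /=; nra.
- by exists (true, false); split => /=; nra.
- have [ba|ab] := leP b (c * a).
    by exists (true, false); split => /=; nra.
  have [ab'|ba] := leP a (c * b).
    by exists (false, true); split => /=; nra.
  by exists (false, false); split => /=; nra.
Qed.

(** Two distinct pieces meet only at the origin, on a half-axis, or on one of the rays z_2 = c z_1
    and z_1 = c z_2, and there the formulas coincide. *)
Lemma piece_grad_unique c i j z : 0 < c < 1 -> piece c i z -> piece c j z ->
  piece_grad c i z = piece_grad c j z.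
Proof.
case: z => a b /andP[c0 c1].
have c20 : 1 - c ^+ 2 != 0 by apply/lt0r_neq0; nra.
have cn0 : c != 0 by apply/lt0r_neq0.
case: i j => [[] []] [[] []] //= [p1 p2] [q1 q2].
- have -> : a = 0 by nra.
  by rewrite mul0r.
- have -> : b = 0 by nra.
  by rewrite mul0r.
- have -> : a = 0 by nra.
  have -> : b = 0 by nra.
  by rewrite !mul0r mulr0 subr0 mul0r.
- have -> : a = 0 by nra.
  by rewrite mul0r.
- have -> : a = 0 by nra.
  have -> : b = 0 by nra.
  by rewrite !mul0r.
- have -> : b = c * a by nra.
  by congr (_, _); field; rewrite ?c20 ?cn0.
- have -> : b = 0 by nra.
  by rewrite mul0r.
- have -> : a = 0 by nra.
  have -> : b = 0 by nra.
  by rewrite !mul0r.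
- have -> : a = c * b by nra.
  by congr (_, _); field; rewrite ?c20 ?cn0.
- have -> : a = 0 by nra.
  have -> : b = 0 by nra.
  by rewrite !mul0r mulr0 subr0 mul0r.
- have -> : b = c * a by nra.
  by congr (_, _); field; rewrite ?c20 ?cn0.
- have -> : a = c * b by nra.
  by congr (_, _); field; rewrite ?c20 ?cn0.
Qed.

(** [r_] tests its cases in order, so a point of piece [i] may be caught by an earlier test; it then
    lies where the two pieces meet, and the values agree there. *)
Lemma r_piece (b : R) (z : 'rV[R]_2) i : 0 < b < 1 ->
  piece (1 - b) i (z 0 0, z 0 1) ->
  r_ b z = piece_val (1 - b) i (z 0 0, z 0 1).
Proof.
move=> /andP[b0 b1].
have enormE : enorm z ^+ 2 = z 0 0 ^+ 2 + z 0 1 ^+ 2.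
  rewrite /enorm sqr_sqrtr /dotv !big_ord_recl big_ord0 addr0.
    by rewrite -!expr2; congr (_ + z _ _ ^+ 2); apply/val_inj.
  by rewrite -!expr2 addr_ge0 ?sqr_ge0.
rewrite /r_ enormE; move: (z 0 0) (z 0 1) => x y.
have bn0 : b != 0 by apply/lt0r_neq0.
have cn0 : 1 - b != 0 by apply/lt0r_neq0; nra.
have b2n0 : 2 - b != 0 by apply/lt0r_neq0; nra.
have ccn0 : 1 - (1 - b) ^+ 2 != 0 by apply/lt0r_neq0; nra.
(* Clears the division, so that the second test of [r_] matches the inequalities of [piece]. *)
rewrite ler_pdivlMr; last by nra.
case: i => [[] []] /= [p1 p2].
- by rewrite p1 p2 /= mulrC.
- case: ifPn => [/andP[q1 q2]|q].
    have -> : x = 0 by nra.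
    by field; rewrite ?bn0 ?cn0 ?b2n0 ?ccn0.
  case: ifPn => [/andP[q1 q2]|q'].
    have -> : y = (1 - b) * x by nra.
    by field; rewrite ?bn0 ?cn0 ?b2n0 ?ccn0.
  rewrite minEle ifF; last by apply/negbTE; rewrite -ltNge; nra.
  by field; rewrite ?bn0 ?cn0 ?b2n0 ?ccn0.
- case: ifPn => [/andP[q1 q2]|q].
    have -> : y = 0 by nra.
    by field; rewrite ?bn0 ?cn0 ?b2n0 ?ccn0.
  case: ifPn => [/andP[q1 q2]|q'].
    have -> : x = (1 - b) * y by nra.
    by field; rewrite ?bn0 ?cn0 ?b2n0 ?ccn0.
  rewrite minEle ifT; last by nra.
  by field; rewrite ?bn0 ?cn0 ?b2n0 ?ccn0.
- case: ifPn => [/andP[q1 q2]|q].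
    have -> : x = 0 by nra.
    have -> : y = 0 by nra.
    by field; rewrite ?bn0 ?cn0 ?b2n0 ?ccn0.
  rewrite p1 (mulrC y) p2 /=.
  by field; rewrite ?bn0 ?cn0 ?b2n0 ?ccn0.
Qed.

End Pieces.

(** * The gradient R_beta, piece by piece *)

Section GradR.
Context {R : realType}.
Implicit Types (b c : R) (i : bool * bool).

Lemma closed_piece (V : topologicalType) c i (g h : V -> R) :
  continuous g -> continuous h -> closed [set y | piece c i (g y, h y)].
Proof.
move=> gc hc.
have cl (u w : V -> R) :
    continuous u -> continuous w -> closed [set y | u y <= w y].
  move=> uc wc; have -> : [set y | u y <= w y] =
      (fun y => u y - w y) @^-1` [set r | r <= 0].
    by apply/seteqP; split => y /=; rewrite subr_le0.
  apply: preimage_closed; last exact: closed_le.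
  by move=> y _; apply: continuousB; [exact: uc|exact: wc].
have cc (r : R) (u : V -> R) : continuous u -> continuous (fun y => r * u y).
  by move=> uc y; apply: cvgM; [exact: cvg_cst|exact: uc].
have c0 : continuous (fun _ : V => 0 : R) by move=> y; exact: cvg_cst.
case: i => [[] []] /=; apply: closedI; apply: cl => //; exact: cc.
Qed.

Lemma is_derive_piece_val (V : normedModType R) c i (g h : V -> R) (x v : V) :
  0 < c < 1 -> derivable g x v -> derivable h x v ->
  is_derive x v (fun y => piece_val c i (g y, h y))
    ((piece_grad c i (g x, h x)).1 * 'D_v g x +
     (piece_grad c i (g x, h x)).2 * 'D_v h x).
Proof.
move=> /andP[c0 c1] /derivableP dg /derivableP dh.
have c20 : 1 - c ^+ 2 != 0 by apply/lt0r_neq0; nra.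
have cn0 : c != 0 by apply/lt0r_neq0.
(* All four values are forms p g^2 + q g h + r h^2, so one product-rule computation serves every
   piece. *)
have quad (p q r : R) :
    is_derive x v (p *: (g * g) + q *: (g * h) + r *: (h * h))
      ((2 * p * g x + q * h x) * 'D_v g x + (q * g x + 2 * r * h x) * 'D_v h x).
  apply: is_derive_eq
    (is_deriveD (is_deriveD (is_deriveZ p (is_deriveM dg dg))
                            (is_deriveZ q (is_deriveM dg dh)))
                (is_deriveZ r (is_deriveM dh dh))) _.
  by rewrite /GRing.scale /=; ring.
have quadP (u : V -> R) (p q r d : R) :
    u =1 (fun y => p * (g y * g y) + q * (g y * h y) + r * (h y * h y)) ->
    d = (2 * p * g x + q * h x) * 'D_v g x +
        (q * g x + 2 * r * h x) * 'D_v h x ->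
    is_derive x v u d.
  by move=> /funext -> ->; exact: quad.
case: i => [[] []] /=.
- by apply: (quadP _ (2 * c)^-1 0 (2 * c)^-1) => [y|]; field; rewrite ?cn0.
- by apply: (quadP _ 0 0 (2 * c)^-1) => [y|]; field; rewrite ?cn0.
- by apply: (quadP _ (2 * c)^-1 0 0) => [y|]; field; rewrite ?cn0.
- apply: (quadP _ (- c / (2 * (1 - c ^+ 2))) (1 - c ^+ 2)^-1
      (- c / (2 * (1 - c ^+ 2)))) => [y|]; field; rewrite ?c20 ?cn0 //.
Qed.

(** Taking [Z] to be the identity yields [R_]; taking it to be F_i yields the chain rule, without
    first proving [r_] differentiable. *)
Lemma is_derive_r_comp (V : normedModType R) b (Z : V -> 'rV[R]_2) (x v : V) i :
  0 < b < 1 ->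
  (forall j, continuous (fun y => Z y 0 j)) ->
  (forall j, derivable (fun y => Z y 0 j) x v) ->
  piece (1 - b) i (Z x 0 0, Z x 0 1) ->
  is_derive x v (fun y => r_ b (Z y))
    ((piece_grad (1 - b) i (Z x 0 0, Z x 0 1)).1 * 'D_v (fun y => Z y 0 0) x +
     (piece_grad (1 - b) i (Z x 0 0, Z x 0 1)).2 * 'D_v (fun y => Z y 0 1) x).
Proof.
move=> b01 Zc dZ Pi.
have c01 : 0 < 1 - b < 1 by lra.
pose pieceZ j : set V := [set y | piece (1 - b) j (Z y 0 0, Z y 0 1)].
pose q j y := piece_val (1 - b) j (Z y 0 0, Z y 0 1).
apply: (@is_derive_glue _ _ _ _ _ q pieceZ).
- by move=> j; exact: closed_piece.
- move=> y; have [j Pj] := piece_cover (Z y 0 0, Z y 0 1) c01.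
  by exists j => //; exact: r_piece.
- move=> j Pj; split; first exact: r_piece.
  rewrite (piece_grad_unique c01 Pi Pj).
  exact: is_derive_piece_val.
Qed.

Lemma coord_derive (n : nat) (z : 'rV[R]_n) (v : 'rV[R]_n) j :
  is_derive z v (fun y : 'rV[R]_n => y 0 j) (v 0 j).
Proof.
apply: DeriveDef; first exact/diff_derivable/differentiable_coord.
have := derive_mx (@derivable_id _ _ z v); rewrite derive_id.
move=> /(congr1 (fun M : 'rV[R]_n => M 0 j)) ->.
by rewrite mxE.
Qed.

Lemma R_piece b (z : 'rV[R]_2) i : 0 < b < 1 ->
  piece (1 - b) i (z 0 0, z 0 1) ->
  R_ b z 0 0 = (piece_grad (1 - b) i (z 0 0, z 0 1)).1 /\
  R_ b z 0 1 = (piece_grad (1 - b) i (z 0 0, z 0 1)).2.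
Proof.
move=> b01 Pi.
have gradE (k : 'I_2) : R_ b z 0 k =
    (piece_grad (1 - b) i (z 0 0, z 0 1)).1 * (delta_mx 0 k : 'rV[R]_2) 0 0 +
    (piece_grad (1 - b) i (z 0 0, z 0 1)).2 * (delta_mx 0 k : 'rV[R]_2) 0 1.
  rewrite /R_ /grad mxE.
  have dcoord j := coord_derive z (delta_mx 0 k) j.
  have := @is_derive_r_comp _ b id z (delta_mx 0 k) i b01
    (fun j => @coord_continuous _ _ _ _ j)
    (fun j => @ex_derive _ _ _ _ _ _ _ (dcoord j)) Pi.
  by move=> /@derive_val ->; rewrite !(@derive_val _ _ _ _ _ _ _ (dcoord _)).
by rewrite !gradE !mxE /= !mulr1 !mulr0 addr0 add0r.
Qed.

End GradR.

(** * Scaling and closedness of the cones, and the signs of R_beta *)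

Section Cones.
Context {R : realType}.
Implicit Types (b t : R) (z y : 'rV[R]_2).

Lemma D_zero : D (0 : 'rV[R]_2).
Proof. by rewrite /D /= !mxE mulr0. Qed.

Lemma N_D0E y : N_D 0 y <-> (y 0 0 <= 0 /\ y 0 1 <= 0) \/ D y.
Proof.
rewrite /N_D /= !mxE ltxx; split=> [[]//|h].
by split => //; exact: D_zero.
Qed.

Lemma N_D_sub_N_DC z y : N_D z y -> N_DC z y.
Proof. by rewrite /N_DC; case: eqP => [->|//]; left. Qed.

Lemma N_DZ t z y : 0 <= t -> N_D z y -> N_D z (t *: y).
Proof.
move=> t0 [Dz h]; split => //; move: h; rewrite /D /= !mxE.
case: ifP => _; first by move=> ->; rewrite mulr0.
case: ifP => _; first by move=> ->; rewrite mulr0.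
move=> [[h1 h2]|[h1 [h2 h3]]]; [left|right; split; [|split]]; nra.
Qed.

Lemma N_DCZ t z y : 0 <= t -> N_DC z y -> N_DC z (t *: y).
Proof.
move=> t0; rewrite /N_DC; case: ifP => _; last exact: N_DZ.
move=> [/N_DZ|[y0 y1]]; first by left; auto.
by right; rewrite /= !mxE !mulr_ge0.
Qed.

Lemma closed_coord_le0 j : closed [set y : 'rV[R]_2 | y 0 j <= 0].
Proof.
apply: (@preimage_closed _ _ (fun y : 'rV[R]_2 => y 0 j) [set r | r <= 0]).
  by move=> y _; exact: coord_continuous.
exact: closed_le.
Qed.

Lemma closed_coord_ge0 j : closed [set y : 'rV[R]_2 | 0 <= y 0 j].
Proof.
apply: (@preimage_closed _ _ (fun y : 'rV[R]_2 => y 0 j) [set r | 0 <= r]).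
  by move=> y _; exact: coord_continuous.
exact: closed_ge.
Qed.

Lemma closed_coord_eq0 j : closed [set y : 'rV[R]_2 | y 0 j = 0].
Proof.
apply: (@preimage_closed _ _ (fun y : 'rV[R]_2 => y 0 j) [set r | r = 0]).
  by move=> y _; exact: coord_continuous.
exact: closed_eq.
Qed.

Lemma closed_D : closed (@D R).
Proof.
apply: closedI; first exact: closed_coord_ge0.
apply: closedI; first exact: closed_coord_ge0.
apply: (@preimage_closed _ _ (fun y : 'rV[R]_2 => y 0 0 * y 0 1)
  [set r | r = 0]).
  by move=> y _; apply: (@cvgM _ _ (nbhs y)); exact: coord_continuous.
exact: closed_eq.
Qed.

Lemma closed_N_D z : D z -> closed (N_D z).
Proof.
move=> Dz; have -> : N_D z = [set y : 'rV[R]_2 | if 0 < z 0 0 then y 0 0 = 0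
     else if 0 < z 0 1 then y 0 1 = 0
     else (y 0 0 <= 0 /\ y 0 1 <= 0) \/ D y].
  by apply/seteqP; split=> [y []|y h].
case: (0 < z 0 0); first exact: closed_coord_eq0.
case: (0 < z 0 1); first exact: closed_coord_eq0.
apply: closedU; last exact: closed_D.
by apply: closedI; exact: closed_coord_le0.
Qed.

Lemma closed_N_DC z : D z -> closed (N_DC z).
Proof.
move=> Dz; rewrite /N_DC; case: ifP => _; last exact: closed_N_D.
apply: closedU; first exact/closed_N_D/D_zero.
by apply: closedI; exact: closed_coord_ge0.
Qed.

(** Packages a piece containing [z] with the positivity of both denominators, so that the signs of
    [R_] can be read off. *)
Lemma R_cases b z : 0 < b < 1 ->
  exists2 i, piece (1 - b) i (z 0 0, z 0 1) &
  [/\ 0 < 1 - b, 0 < 1 - (1 - b) ^+ 2,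
      R_ b z 0 0 = (piece_grad (1 - b) i (z 0 0, z 0 1)).1 &
      R_ b z 0 1 = (piece_grad (1 - b) i (z 0 0, z 0 1)).2].
Proof.
move=> b01; have c01 : 0 < 1 - b < 1 by lra.
have [i Pi] := piece_cover (z 0 0, z 0 1) c01.
have [R0 R1] := R_piece b01 Pi.
case/andP: b01 => b0 b1; exists i => //; split => //; first by lra.
have : 0 < b * (2 - b) by apply: mulr_gt0; lra.
by congr (0 < _); ring.
Qed.

(** Both entries are nonpositive on [(true, true)] and nonnegative on [(false, false)]; on the mixed
    pieces one entry is 0 and the other has the sign of its coordinate. *)
Lemma R_N_DC b z : 0 < b < 1 -> N_DC 0 (R_ b z).
Proof.
move=> b01; rewrite /N_DC eqxx; have [i] := R_cases z b01.
case: i => [[] []] /= [p1 p2] [c0 d0 R0 R1].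
- by left; apply/N_D0E; left; rewrite R0 R1 !pmulr_lle0 ?invr_gt0.
- have [z1|z1] := leP (z 0 1) 0.
    by left; apply/N_D0E; left; rewrite R0 R1 pmulr_lle0 ?invr_gt0.
  by right; split; rewrite /= ?R0 ?R1 // divr_ge0 // ltW.
- have [z1|z1] := leP (z 0 0) 0.
    by left; apply/N_D0E; left; rewrite R0 R1 pmulr_lle0 ?invr_gt0.
  by right; split; rewrite /= ?R0 ?R1 // divr_ge0 // ltW.
- by right; split; rewrite /= ?R0 ?R1 divr_ge0 ?(ltW d0) ?subr_ge0.
Qed.

(** Only [(false, false)] can produce values outside N_D(0), and apart from the origin that piece
    lies in the open positive quadrant. *)
Lemma R_N_D b z : 0 < b < 1 -> ~ (0 < z 0 0 /\ 0 < z 0 1) -> N_D 0 (R_ b z).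
Proof.
move=> b01 z_quadrant; apply/N_D0E; have [i] := R_cases z b01.
rewrite /D /=; case: i => [[] []] /= [p1 p2] [c0 d0 R0 R1]; rewrite R0 R1.
- by left; rewrite !pmulr_lle0 ?invr_gt0.
- have [z1|z1] := leP (z 0 1) 0; [left|right].
    by rewrite pmulr_lle0 ?invr_gt0.
  by rewrite mul0r divr_ge0 // ltW.
- have [z1|z1] := leP (z 0 0) 0; [left|right].
    by rewrite pmulr_lle0 ?invr_gt0.
  by rewrite mulr0 divr_ge0 // ltW.
- have z0 : 0 <= z 0 0 by nra.
  have z1 : 0 <= z 0 1 by nra.
  have [z00|z0n] := eqVneq (z 0 0) 0.
    have -> : z 0 1 = 0 by nra.
    by rewrite z00 !(mulr0, subr0, mul0r, lexx); left.
  have [z10|z1n] := eqVneq (z 0 1) 0.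
    have -> : z 0 0 = 0 by nra.
    by rewrite z10 !(mulr0, subr0, mul0r, lexx); left.
  by exfalso; apply: z_quadrant; rewrite !lt_neqAle z0 z1 eq_sym z0n eq_sym z1n.
Qed.

(** The strict inequality excludes every piece but [(true, false)], whose gradient has first entry
    0. *)
Lemma R_dominated0 b z : 0 < b < 1 -> 0 < z 0 0 ->
  z 0 1 < (1 - b) * z 0 0 -> R_ b z 0 0 = 0.
Proof.
move=> b01 z0 z1; have [i] := R_cases z b01.
by case: i => [[] []] /= [p1 p2] [c0 d0 -> _] //; exfalso; nra.
Qed.

Lemma R_dominated1 b z : 0 < b < 1 -> 0 < z 0 1 ->
  z 0 0 < (1 - b) * z 0 1 -> R_ b z 0 1 = 0.
Proof.
move=> b01 z0 z1; have [i] := R_cases z b01.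
by case: i => [[] []] /= [p1 p2] [c0 d0 _ ->] //; exfalso; nra.
Qed.

(** Serves a constant G_i equal to 0: BCCQ says nothing about its multiplier entry, which must
    vanish for another reason. *)
Lemma R_zero0 b z : 0 < b < 1 -> z 0 0 = 0 -> R_ b z 0 0 = 0.
Proof.
move=> b01 z0; have [i] := R_cases z b01; rewrite z0.
case: i => [[] []] /= [p1 p2] [c0 d0 -> _] //; rewrite ?mul0r //.
have -> : z 0 1 = 0 by nra.
by rewrite mulr0 subr0 mul0r.
Qed.

Lemma R_zero1 b z : 0 < b < 1 -> z 0 1 = 0 -> R_ b z 0 1 = 0.
Proof.
move=> b01 z0; have [i] := R_cases z b01; rewrite z0.
case: i => [[] []] /= [p1 p2] [c0 d0 _ ->] //; rewrite ?mul0r //.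
have -> : z 0 0 = 0 by nra.
by rewrite mulr0 subr0 mul0r.
Qed.

End Cones.

(** * The gradient of the penalized objective *)

Section Gradient.
Context {R : realType} {n p : nat}.
Variables (f : 'rV[R]_n -> R) (G H : 'rV[R]_n -> 'rV[R]_p).

Lemma F_coord0 i x : F G H i x 0 0 = component G i x.
Proof. by rewrite /F mxE. Qed.

Lemma F_coord1 i x : F G H i x 0 1 = component H i x.
Proof. by rewrite /F mxE. Qed.

Lemma mulmx_JF i x (y : 'rV[R]_2) j : (y *m JF G H i x) 0 j =
  y 0 0 * grad (component G i) x 0 j + y 0 1 * grad (component H i) x 0 j.
Proof.
rewrite mxE (big_ord_recl 1) big_ord1 /JF; congr (y _ _ * _ + y _ _ * _).
- by rewrite -(col_mxEu (grad (component G i) x) (grad (component H i) x));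
    congr (_ _ j); apply/val_inj.
- by apply/val_inj.
- by rewrite -(col_mxEd (grad (component G i) x) (grad (component H i) x));
    congr (_ _ j); apply/val_inj.
Qed.

Hypotheses (f_smooth : smooth f) (G_smooth : forall i, smooth (component G i))
  (H_smooth : forall i, smooth (component H i)).

(** The chain rule through each F_i, with 1 / lambda absorbed into the multiplier: near-stationarity
    for [s_] becomes approximate C-stationarity. *)
Lemma grad_s lambda b x : 0 < b < 1 ->
  grad (s_ f G H lambda b) x =
  grad f x + \sum_(i < p) row i (multiplier G H lambda b x) *m JF G H i x.
Proof.
move=> b01; apply/rowP => j; rewrite !mxE summxE.
have c01 : 0 < 1 - b < 1 by lra.
set e := delta_mx 0 j.
have dF i (k : 'I_2) y v : derivable (fun y => F G H i y 0 k) y v.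
  apply: diff_derivable; have [k0|k1] := eqVneq k 0.
    under eq_fun do rewrite k0 F_coord0.
    exact: (G_smooth i).1.
  have {}k1 : k = 1 by apply/val_inj; case: k k1 => [[|[|]]].
  under eq_fun do rewrite k1 F_coord1.
  exact: (H_smooth i).1.
have cF i (k : 'I_2) : continuous (fun y => F G H i y 0 k).
  move=> y; have [k0|k1] := eqVneq k 0.
    under eq_fun do rewrite k0 F_coord0.
    exact/differentiable_continuous/(G_smooth i).1.
  have {}k1 : k = 1 by apply/val_inj; case: k k1 => [[|[|]]].
  under eq_fun do rewrite k1 F_coord1.
  exact/differentiable_continuous/(H_smooth i).1.
have dr i : is_derive x e (fun y => r_ b (F G H i y))
    (R_ b (F G H i x) 0 0 * grad (component G i) x 0 j +
     R_ b (F G H i x) 0 1 * grad (component H i) x 0 j).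
  have [k Pk] := piece_cover (F G H i x 0 0, F G H i x 0 1) c01.
  have [-> ->] := R_piece b01 Pk.
  have := is_derive_r_comp b01 (cF i) (fun k => dF i k x e) Pk.
  have GE : (fun y => F G H i y 0 0) = component G i.
    exact/funext/F_coord0.
  have HE : (fun y => F G H i y 0 1) = component H i.
    exact/funext/F_coord1.
  by rewrite GE HE /grad !mxE.
have df : is_derive x e f ('D_e f x).
  exact/derivableP/diff_derivable/f_smooth.1.
have -> : s_ f G H lambda b =
    f + lambda^-1 *: \sum_(i < p) (fun y => r_ b (F G H i y)).
  by apply/funext => y; rewrite /s_ /= !fctE fct_sumE.
have ds := is_deriveD df (is_deriveZ lambda^-1 (is_derive_sum dr)).
rewrite (@derive_val _ _ _ _ _ _ _ ds); congr (_ + _).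
rewrite /GRing.scale /= mulr_sumr; apply: eq_bigr => i _.
by rewrite mulmx_JF !mxE /multiplier mulrDr !mulrA.
Qed.

End Gradient.

(** * Compactness, distances and limits of normal vectors *)

Section Sequences.
Context {R : realType}.

Lemma cvg_mxP {T : Type} {F : set_system T} {FF : Filter F} m n
    (M : T -> 'M[R]_(m, n)) (L : 'M[R]_(m, n)) :
  M @ F --> L <-> forall i j, (fun t => M t i j) @ F --> L i j.
Proof.
split=> [ML i j|ML].
  exact: (cvg_comp _ (fun N : 'M[R]_(m, n) => N i j) ML
    (@coord_continuous R m n i j L)).
apply/cvgrPdist_le => e e0; near=> t.
rewrite [leLHS]/Num.Def.normr /= mx_normrE; apply: bigmax_le; first exact: ltW.
move=> ij _; rewrite !mxE; move: ij; near: t; apply: filter_forall => -[i j] /=.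
by move/cvgrPdist_le: (ML i j); apply.
Unshelve. all: by end_near. Qed.

Lemma extraction_cvg_infty (phi : nat -> nat) :
  extraction phi -> phi @ \oo --> \oo.
Proof.
move=> phi_incr; have phi_ge k : (k <= phi k)%N.
  by elim: k => // k /leq_ltn_trans; apply; exact: phi_incr.
move=> A [N _ NA]; exists N => // k /= Nk.
by apply: NA => /=; exact: leq_trans (phi_ge k).
Qed.

(** Vectorized, the sequence lies in the compact box [-M, M]^(m n) and so has a cluster point, to
    which a subsequence converges. *)
Lemma bolzano_weierstrass_mx m n (w : nat -> 'M[R]_(m, n)) (M : R) :
  (forall k, `|w k| <= M) ->
  exists psi (L : 'M[R]_(m, n)), extraction psi /\ (w \o psi) @ \oo --> L.
Proof.
move=> wM; pose v k := mxvec (w k).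
have coordM k i : `|v k 0 i| <= M.
  case/mxvec_indexP: i => i j; rewrite /v mxvecE; apply: le_trans (wM k).
  by rewrite [leRHS]/Num.Def.normr /= mx_normrE; apply: (le_bigmax _ _ (i, j)).
have Kc : compact
    [set u : 'rV[R]_(m * n) | forall i, `[- M, M]%classic (u 0 i)].
  by apply: (@rV_compact _ _ (fun=> `[- M, M]%classic)) => _;
    exact: segment_compact.
have [|L [_ vL]] := Kc (v @ \oo) (fmap_proper_filter _ _).
  by exists 0 => // k _ i /=; rewrite in_itv /= -ler_norml.
(* The library extracts convergent subsequences of real sequences only, hence
   the detour through the distances to L. *)
have : cluster ((fun k => `|L - v k|) @ \oo) 0.
  apply/cluster_eventuallyP => e N e0.
  have [u []] := vL (v @` [set k | (N <= k)%N]) (ball L e)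
    (filterS (fun k Nk => ex_intro2 _ _ k Nk erefl) (nbhs_infty_ge N))
    (nbhsx_ballx L e e0).
  move=> [k /= Nk <-]; rewrite -ball_normE /= => Lk.
  by exists k => //; rewrite sub0r normrN normr_id ltW.
move=> /cluster_eventually_cvg[psi psi_incr Lpsi].
exists psi, (vec_mx L); split.
  by move=> k l kl; rewrite ltnNge -leEnat psi_incr -ltnNge.
have {}Lpsi : (v \o psi) @ \oo --> L.
  by apply/subr_cvg0/norm_cvg0P; apply: cvg_trans Lpsi; apply: near_eq_cvg;
    near=> k; rewrite /= distrC.
move/cvg_mxP: Lpsi => Lpsi; apply/cvg_mxP => i j.
have := Lpsi 0 (mxvec_index i j); rewrite mxE.
by under eq_fun do rewrite /= /v mxvecE.
Unshelve. all: by end_near. Qed.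

Lemma enorm_ge_coord n (v : 'rV[R]_n) j : `|v 0 j| <= enorm v.
Proof.
rewrite -sqrtr_sqr ler_wsqrtr // /dotv (bigD1 j) //= -expr2 lerDl.
by apply: sumr_ge0 => k _; rewrite -expr2 sqr_ge0.
Qed.

(** The infimum need not be attained, so points within 1 / (k + 1) of it are chosen; the error still
    tends to 0. *)
Lemma dist_cvg0_approx n (a : nat -> 'rV[R]_n) (A : nat -> set 'rV[R]_n) :
  (fun k => dist (a k) (A k)) @ \oo --> 0%E ->
  exists v : nat -> 'rV[R]_n, (\forall k \near \oo, A k (v k)) /\
    forall j, (fun k => a k 0 j - v k 0 j) @ \oo --> (0 : R).
Proof.
move=> dA.
have [dfin dfine] := (fine_cvgP _ _).1 dA.
pose near_pt k : set 'rV[R]_n :=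
  [set v | A k v /\ enorm (a k - v) < fine (dist (a k) (A k)) + k.+1%:R^-1].
have near_ex : \forall k \near \oo, near_pt k (xget 0 (near_pt k)).
  (* A finite distance makes [near_pt k] nonempty, so [xget] returns one of its points; the default
     0 can occur only where the distance is infinite. *)
  apply: filterS dfin => k dk.
  have [|_ [v Av <-] vlt] := lb_ereal_inf_adherent (e := k.+1%:R^-1) _ dk.
    by rewrite invr_gt0.
  apply: (xgetPex 0); exists v; split => //.
  by rewrite -lte_fin EFinD fineK.
exists (fun k => xget 0 (near_pt k)); split.
  by apply: filterS near_ex => k [].
move=> j; apply/norm_cvg0P.
apply: (@squeeze_cvgr _ _ _ _ (cst 0)
  (fun k => fine (dist (a k) (A k)) + k.+1%:R^-1)).
- apply: filterS near_ex => k [_ /ltW]; rewrite normr_ge0; apply: le_trans.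
  by have := enorm_ge_coord (a k - xget 0 (near_pt k)) j; rewrite !mxE.
- exact: cvg_cst.
- by rewrite -[X in _ --> X]addr0; apply: cvgD;
    [exact: dfine|exact: cvg_harmonic].
Qed.

Lemma cvg_dotv {T : Type} {F : set_system T} {FF : Filter F} n
    (u v : T -> 'rV[R]_n) (u0 v0 : 'rV[R]_n) :
  (forall j, (fun t => u t 0 j) @ F --> u0 0 j) ->
  (forall j, (fun t => v t 0 j) @ F --> v0 0 j) ->
  (fun t => dotv (u t) (v t)) @ F --> dotv u0 v0.
Proof.
move=> uu vv; apply: cvg_big => [|j _]; first exact: add_continuous.
by apply: cvgM; [exact: uu|exact: vv].
Qed.

(** For each fixed [y] in [C], the inequality [dotv (v k) (y - x k) <= 0] passes to the limit by
    continuity of the inner product. *)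
Lemma normal_cone_cvg n (C : set 'rV[R]_n) (x v : nat -> 'rV[R]_n)
    (x0 v0 : 'rV[R]_n) :
  closed C -> x @ \oo --> x0 ->
  (forall j, (fun k => v k 0 j) @ \oo --> v0 0 j) ->
  (\forall k \near \oo, normal_cone C (x k) (v k)) -> normal_cone C x0 v0.
Proof.
move=> Ccl xx0 vv0 Nv; split.
  by apply: (closed_cvg C Ccl _ _ xx0); apply: filterS Nv => k [].
move=> y Cy.
have dot_cvg : (fun k => dotv (v k) (y - x k)) @ \oo --> dotv v0 (y - x0).
  apply: cvg_dotv => // j; have /cvg_mxP/(_ 0 j) xj := xx0.
  rewrite !mxE; under eq_fun do rewrite !mxE.
  by apply: cvgB => //; exact: cvg_cst.
apply: (closed_cvg [set r : R | r <= 0] (@closed_le R 0) _ _ dot_cvg).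
by apply: filterS Nv => k [_]; exact.
Qed.

(** The limsup is an infimum of suprema over neighbourhoods of infinity, one of which is already
    below [b]. Applied to beta, this keeps 1 - beta away from 0. *)
Lemma limn_esup_lt_near (u : nat -> R) (b : R) :
  (limn_esup (fun k => (u k)%:E) < b%:E)%E ->
  exists2 B, B < b & \forall k \near \oo, u k <= B.
Proof.
rewrite /limn_esup limf_esupE => /ereal_inf_lt[_ [V Voo <-] supb].
have [N _ NV] := Voo.
have uV k : V k -> ((u k)%:E <= ereal_sup [set (u i)%:E | i in V])%E.
  by move=> Vk; apply: ereal_sup_ubound; exists k.
move: supb uV; case: (ereal_sup _) => [s|//|] supb uV.
  by exists s; rewrite -?lte_fin //; exists N => // k /NV /uV; rewrite lee_fin.
(* A supremum equal to -oo is impossible because [V] contains [N]. *)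
by have := uV N (NV N (leqnn N)).
Qed.

End Sequences.

Lemma normal_coneZ (R : realType) n (C : set 'rV[R]_n) x (v : 'rV[R]_n) t :
  0 <= t -> normal_cone C x v -> normal_cone C x (t *: v).
Proof.
move=> t0 [Cx Nv]; split => // y Cy.
rewrite /dotv; under eq_bigr do rewrite mxE -mulrA.
by rewrite -mulr_sumr mulr_ge0_le0 //; exact: Nv.
Qed.

(** * The multipliers along the sequence and their limits *)

Section Multipliers.
Context {R : realType} {n p : nat}.
Variables (f : 'rV[R]_n -> R) (G H : 'rV[R]_n -> 'rV[R]_p) (C : set 'rV[R]_n).
Variables (lambda beta : nat -> R) (xs : nat -> 'rV[R]_n) (x : 'rV[R]_n).
Hypotheses (f_smooth : smooth f) (G_smooth : forall i, smooth (component G i))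
  (H_smooth : forall i, smooth (component H i)) (C_closed : closed C).
Hypotheses (lambda_gt0 : forall k, 0 < lambda k)
  (beta_01 : forall k, 0 < beta k < 1)
  (beta_limsup : (limn_esup (fun k => (beta k)%:E) < 1)%E).
Hypothesis dist_cvg :
  (fun k => dist (- grad (s_ f G H (lambda k) (beta k)) (xs k))
                 (normal_cone C (xs k))) @ \oo --> 0%E.
Hypotheses (xs_cvg : xs @ \oo --> x) (x_D : forall i, D (F G H i x)).

Let ys k := multiplier G H (lambda k) (beta k) (xs k).

Let ysE k i j : ys k i j = (lambda k)^-1 * R_ (beta k) (F G H i (xs k)) 0 j.
Proof. by rewrite /ys /multiplier !mxE. Qed.

Let row_ys k i : row i (ys k) = (lambda k)^-1 *: R_ (beta k) (F G H i (xs k)).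
Proof. by apply/rowP => j; rewrite [LHS]mxE ysE [RHS]mxE. Qed.

Lemma smooth_cvg (g : 'rV[R]_n -> R) : smooth g -> (g \o xs) @ \oo --> g x.
Proof.
move=> [dg _].
exact: (cvg_comp _ g xs_cvg (differentiable_continuous (dg x))).
Qed.

Lemma grad_cvg (g : 'rV[R]_n -> R) j : smooth g ->
  (fun k => grad g (xs k) 0 j) @ \oo --> grad g x 0 j.
Proof.
move=> [_ cg]; have : (grad g \o xs) @ \oo --> grad g x.
  exact: (cvg_comp _ (grad g) xs_cvg (cg x)).
by move=> /cvg_mxP; exact.
Qed.

(** If one coordinate of F_i(x) is positive, the other tends to 0 and is eventually dominated, so
    the entry of the positive one vanishes. If F_i(x) = 0, the global sign results apply, and
    well-behavedness keeps nearby values out of the open quadrant. *)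
Lemma multiplier_near i : \forall k \near \oo,
  [/\ N_DC (F G H i x) (row i (ys k)),
      well_behaved G H i -> N_D (F G H i x) (row i (ys k)),
      is_constant (component G i) -> ys k i 0 = 0 &
      is_constant (component H i) -> ys k i 1 = 0].
Proof.
have [B B1 betaB] := limn_esup_lt_near beta_limsup.
have Gcvg := smooth_cvg (G_smooth i).
have Hcvg := smooth_cvg (H_smooth i).
have lambdaV k : 0 <= (lambda k)^-1 by rewrite invr_ge0 ltW.
have Dx := x_D i; have [] := x_D i; rewrite F_coord0 F_coord1.
set a := component G i x; set b := component H i x => a0 [b0 ab0].
(* A constant component keeps its value at [x] along the whole sequence. *)
have constG0 k : is_constant (component G i) -> a = 0 -> ys k i 0 = 0.
  move=> [c cE] a00; rewrite ysE R_zero0 ?mulr0 // F_coord0.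
  by rewrite cE -(cE x).
have constH0 k : is_constant (component H i) -> b = 0 -> ys k i 1 = 0.
  move=> [c cE] b00; rewrite ysE R_zero1 ?mulr0 // F_coord1.
  by rewrite cE -(cE x).
have [a_gt0|a_le0] := ltP 0 a.
  have b00 : b = 0 by move/eqP: ab0; rewrite mulf_eq0 gt_eqF //= => /eqP.
  have y0 : \forall k \near \oo, ys k i 0 = 0.
    near=> k; rewrite ysE R_dominated0 ?mulr0 // ?F_coord0 ?F_coord1.
      by near: k; apply: (cvgr_gt _ Gcvg).
    (* With beta k <= B, the bounds chain to H_i < (1 - B) a / 2 <= (1 - beta k) a / 2 < (1 - beta
       k) G_i. *)
    have ga : a / 2 < component G i (xs k).
      by near: k; apply: (cvgr_gt _ Gcvg); rewrite -/a; lra.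
    have hb : component H i (xs k) < (1 - B) * (a / 2).
      near: k; apply: (cvgr_lt _ Hcvg); rewrite -/b b00.
      by rewrite mulr_gt0 ?subr_gt0 // divr_gt0.
    have bB : beta k <= B by near: k.
    nra.
  apply: filterS y0 => k y0.
  have ND : N_D (F G H i x) (row i (ys k)).
    by split => //; rewrite F_coord0 a_gt0 mxE.
  by split; auto => //; exact: N_D_sub_N_DC.
have a00 : a = 0 by apply/eqP; rewrite eq_le a_le0 a0.
have [b_gt0|b_le0] := ltP 0 b.
  have y1 : \forall k \near \oo, ys k i 1 = 0.
    near=> k; rewrite ysE R_dominated1 ?mulr0 // ?F_coord0 ?F_coord1.
      by near: k; apply: (cvgr_gt _ Hcvg).
    have ga : b / 2 < component H i (xs k).
      by near: k; apply: (cvgr_gt _ Hcvg); rewrite -/b; lra.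
    have hb : component G i (xs k) < (1 - B) * (b / 2).
      near: k; apply: (cvgr_lt _ Gcvg); rewrite -/a a00.
      by rewrite mulr_gt0 ?subr_gt0 // divr_gt0.
    have bB : beta k <= B by near: k.
    nra.
  apply: filterS y1 => k y1.
  have ND : N_D (F G H i x) (row i (ys k)).
    by split => //; rewrite F_coord0 -/a a00 ltxx F_coord1 b_gt0 mxE.
  by split; auto => //; exact: N_D_sub_N_DC.
have b00 : b = 0 by apply/eqP; rewrite eq_le b_le0 b0.
have Fx0 : F G H i x = 0.
  apply/rowP => j; rewrite !mxE.
  by case: ifP => _; [exact: a00|exact: b00].
have [wb|nwb] := pselect (well_behaved G H i); last first.
  apply: nearW => k; split; auto => //.
  by rewrite row_ys Fx0; apply: N_DCZ => //; exact: R_N_DC.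
have [xi xi0 xiP] := wb.
(* Two coordinates of absolute value below xi / 2 have Euclidean norm at most xi. *)
have small : \forall k \near \oo, enorm (F G H i (xs k)) <= xi.
  near=> k.
  have Gs : `|component G i (xs k)| < xi / 2.
    have : `|a - component G i (xs k)| < xi / 2.
      by near: k; move/cvgrPdist_lt: Gcvg; apply; exact: divr_gt0.
    by rewrite a00 sub0r normrN.
  have Hs : `|component H i (xs k)| < xi / 2.
    have : `|b - component H i (xs k)| < xi / 2.
      by near: k; move/cvgrPdist_lt: Hcvg; apply; exact: divr_gt0.
    by rewrite b00 sub0r normrN.
  rewrite -[leRHS](ger0_norm (ltW xi0)) -sqrtr_sqr ler_wsqrtr //.
  rewrite /dotv (big_ord_recl 1) big_ord1.
  have -> : lift ord0 ord0 = 1 :> 'I_2 by apply/val_inj.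
  rewrite !F_coord0 !F_coord1 -!expr2.
  move: Gs Hs; rewrite !ltr_norml => /andP[? ?] /andP[? ?].
  nra.
apply: filterS small => k small.
have ND : N_D (F G H i x) (row i (ys k)).
  rewrite row_ys Fx0; apply: N_DZ => //; apply: R_N_D => // -[h1 h2].
  exact: (xiP (xs k)).
by split; auto => //; exact: N_D_sub_N_DC.
Unshelve. all: by end_near. Qed.

(** The factor [t] lets one passage to the limit cover both the original and the normalized
    multipliers; [u] need only tend to infinity, since the indices of an unbounded sequence are not
    chosen monotonically. *)
Lemma limit_multiplier (u : nat -> nat) (tau : nat -> R) (t : R)
    (y : 'M[R]_(p, 2)) :
  u @ \oo --> \oo -> (forall k, 0 <= tau k) -> tau @ \oo --> t ->
  (fun k => tau k *: ys (u k)) @ \oo --> y ->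
  (exists2 v, normal_cone C x v &
     0 = t *: grad f x + \sum_(i < p) row i y *m JF G H i x + v) /\
  forall i, [/\ N_DC (F G H i x) (row i y),
      well_behaved G H i -> N_D (F G H i x) (row i y),
      is_constant (component G i) -> y i 0 = 0 &
      is_constant (component H i) -> y i 1 = 0].
Proof.
move=> u_infty tau0 tau_cvg y_cvg.
have near_u (Q : nat -> Prop) :
    (\forall k \near \oo, Q k) -> \forall k \near \oo, Q (u k).
  by move=> Qoo; exact: u_infty.
have y_coord i j : (fun k => tau k * ys (u k) i j) @ \oo --> y i j.
  have /cvg_mxP/(_ i j) := y_cvg.
  by under eq_fun do rewrite mxE.
split; last first.
  move=> i; have near_i := near_u _ (multiplier_near i).
  have row_cvg : (fun k => tau k *: row i (ys (u k))) @ \oo --> row i y.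
    apply/cvg_mxP => i0 j; rewrite mxE.
    by under eq_fun do rewrite mxE [row _ _ _ _]mxE; exact: y_coord.
  split.
  - apply: (closed_cvg _ (closed_N_DC (x_D i)) _ _ row_cvg).
    by apply: filterS near_i => k [NDC _ _ _]; exact: N_DCZ (tau0 k) NDC.
  - move=> wb; apply: (closed_cvg _ (closed_N_D (x_D i)) _ _ row_cvg).
    by apply: filterS near_i => k [_ /(_ wb) ND _ _]; exact: N_DZ (tau0 k) ND.
  - move=> cG; apply: (closed_cvg [set r : R | r = 0] (@closed_eq R 0) _ _
      (y_coord i 0)).
    by apply: filterS near_i => k [_ _ /(_ cG) /= -> _]; rewrite mulr0.
  - move=> cH; apply: (closed_cvg [set r : R | r = 0] (@closed_eq R 0) _ _
      (y_coord i 1)).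
    by apply: filterS near_i => k [_ _ _ /(_ cH) /= ->]; rewrite mulr0.
have [V [VN Vcvg]] := dist_cvg0_approx dist_cvg.
(* The equation forces this normal vector; it is the limit of [tau k *: V (u k)], with [V] the
   approximating normal vectors. *)
exists (- (t *: grad f x + \sum_(i < p) row i y *m JF G H i x));
  last by rewrite subrr.
have sub_cvg (w : nat -> R) (l : R) : w @ \oo --> l -> (w \o u) @ \oo --> l.
  exact: cvg_comp.
have xu_cvg : (xs \o u) @ \oo --> x by exact: (cvg_comp _ _ u_infty xs_cvg).
apply: (normal_cone_cvg (v := fun k => tau k *: V (u k)) C_closed xu_cvg);
  last first.
  by apply: filterS (near_u _ VN) => k; exact: normal_coneZ.
move=> j.
(* Splits V = - grad s - (- grad s - V): the first part has the wanted limit, and the error tends to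
   0 even after scaling by [tau k]. *)
have VE k : (tau k *: V (u k)) 0 j =
    - (tau k * grad f (xs (u k)) 0 j +
       \sum_(i < p)
         (tau k * ys (u k) i 0 * grad (component G i) (xs (u k)) 0 j +
          tau k * ys (u k) i 1 * grad (component H i) (xs (u k)) 0 j)) -
    tau k * ((- grad (s_ f G H (lambda (u k)) (beta (u k))) (xs (u k))) 0 j -
             V (u k) 0 j).
  rewrite grad_s // !mxE summxE.
  under [in RHS]eq_bigr do rewrite -!mulrA -mulrDr.
  rewrite -mulr_sumr.
  under [in X in _ = _ - X]eq_bigr do rewrite mulmx_JF ![row _ _ _ _]mxE.
  rewrite -/(ys (u k)); ring.
under eq_fun do rewrite VE.
have -> : (- (t *: grad f x + \sum_(i < p) row i y *m JF G H i x)) 0 j =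
    - (t * grad f x 0 j +
       \sum_(i < p) (y i 0 * grad (component G i) x 0 j +
                     y i 1 * grad (component H i) x 0 j)) - t * 0.
  rewrite !mxE summxE mulr0 subr0; congr (- (_ + _)).
  by apply: eq_bigr => i _; rewrite mulmx_JF ![row _ _ _ _]mxE.
apply: cvgB; last exact: (cvgM tau_cvg (sub_cvg _ _ (Vcvg j))).
apply: cvgN; apply: cvgD.
  exact: (cvgM tau_cvg (sub_cvg _ _ (grad_cvg f_smooth))).
apply: cvg_big => [|i _]; first exact: add_continuous.
apply: cvgD; apply: cvgM; try exact: y_coord.
  exact: sub_cvg _ _ (grad_cvg (G_smooth i)).
exact: sub_cvg _ _ (grad_cvg (H_smooth i)).
Qed.

Lemma multiplier_bounded : BCCQ G H C x -> exists M, forall k, `|ys k| <= M.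
Proof.
move=> x_BCCQ; apply: contrapT => /forallNP unbounded.
(* The sum dominates every norm up to index k, which forces u k > k; the summand k + 1 makes the
   norms tend to infinity. *)
have /choice[u uP] : forall k, exists l,
    k.+1%:R + \sum_(m < k.+1) `|ys m| < `|ys l|.
  move=> k; apply: contrapT => /forallNP no_l.
  apply: (unbounded (k.+1%:R + \sum_(m < k.+1) `|ys m|)) => l.
  by rewrite leNgt; exact/negP/no_l.
have u_large k : k.+1%:R < `|ys (u k)|.
  by apply: le_lt_trans (uP k); rewrite lerDl sumr_ge0.
have u_gt k : (k < u k)%N.
  rewrite ltnNge; apply/negP => uk.
  have := uP k; rewrite ltNge => /negP; apply.
  rewrite (bigD1 (Ordinal (uk : (u k < k.+1)%N))) //= addrCA lerDl.
  by rewrite addr_ge0 // sumr_ge0.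
have ys_gt0 k : 0 < `|ys (u k)| by apply: le_lt_trans (u_large k).
pose tau k := `|ys (u k)|^-1.
have norm1 k : `|tau k *: ys (u k)| = 1.
  by rewrite normrZ ger0_norm ?invr_ge0 // mulVf // gt_eqF.
have norm_le1 k : `|tau k *: ys (u k)| <= 1 by rewrite norm1.
have [psi [y [psi_extr y_cvg]]] := bolzano_weierstrass_mx norm_le1.
have psi_infty := extraction_cvg_infty psi_extr.
have u_infty : u @ \oo --> \oo.
  move=> A [N _ NA]; exists N => // k /= Nk; apply: NA => /=.
  exact/ltnW/(leq_ltn_trans Nk).
have tau_cvg : tau @ \oo --> (0 : R).
  apply: (@squeeze_cvgr _ _ _ _ (cst 0) harmonic).
  - apply: nearW => k; rewrite invr_ge0 normr_ge0 /= /tau.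
    by rewrite lef_pV2 ?posrE // ltW.
  - exact: cvg_cst.
  - exact: cvg_harmonic.
have tau_ge0 k : 0 <= (tau \o psi) k by rewrite invr_ge0.
have [[v Nv v_sum] y_cones] := limit_multiplier (cvg_comp _ _ psi_infty u_infty)
  tau_ge0 (cvg_comp _ _ psi_infty tau_cvg) y_cvg.
(* BCCQ annihilates the entries of nonconstant components; those of constant components vanish as
   limits of zeros. *)
have y0 : y = 0.
  have BC := x_BCCQ y (fun i wb => let: And4 _ h _ _ := y_cones i in h wb)
    (fun i _ => let: And4 h _ _ _ := y_cones i in h).
  have {}BC : forall i, (is_constant (component G i) \/ y i 0 = 0) /\
      (is_constant (component H i) \/ y i 1 = 0).
    by apply: BC; exists v => //; move: v_sum; rewrite scale0r add0r.
  apply/matrixP => i j; rewrite mxE.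
  have [_ _ yG yH] := y_cones i; have [yG' yH'] := BC i.
  have [->|j1] := eqVneq j 0; first by case: yG'.
  have -> : j = 1 by apply/val_inj; case: j j1 => [[|[|]]].
  by case: yH'.
(* The normalized multipliers all have norm 1, yet their limit is 0. *)
have norm_cvg : (fun=> 1 : R) @ \oo --> (0 : R).
  rewrite -(normr0 'M[R]_(p, 2)) -y0.
  have -> : (fun=> 1) = (fun k => `|tau (psi k) *: ys (u (psi k))|).
    by apply/funext => k; rewrite norm1.
  exact: cvg_norm y_cvg.
have /eqP : 1 = 0 :> R by exact: (cvg_unique _ (cvg_cst (1 : R)) norm_cvg).
by rewrite oner_eq0.
Qed.

End Multipliers.

Theorem theorem4p8 (R : realType) (n p : nat)
  (f : 'rV[R]_n -> R) (G H : 'rV[R]_n -> 'rV[R]_p) (C : set 'rV[R]_n)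
  (f_smooth : smooth f)
  (G_smooth : forall i, smooth (component G i))
  (H_smooth : forall i, smooth (component H i))
  (C_nonempty : C !=set0) (C_closed : closed C) (C_convex : convex_set C)
  (solvable : exists xsol, solution f G H C xsol)
  (lambda beta : nat -> R) (xs : nat -> 'rV[R]_n) (x : 'rV[R]_n)
  (lambda_gt0 : forall k, 0 < lambda k)
  (beta_01 : forall k, 0 < beta k < 1)
  (lambda_cvg : lambda @ \oo --> (0 : R))
  (beta_limsup : (limn_esup (fun k => (beta k)%:E) < 1)%E)
  (dist_cvg : (fun k => dist (- grad (s_ f G H (lambda k) (beta k)) (xs k))
                             (normal_cone C (xs k))) @ \oo --> 0%E)
  (xs_cvg : xs @ \oo --> x)
  (x_D : forall i, D (F G H i x))
  (x_BCCQ : BCCQ G H C x) :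
  let ys k := multiplier G H (lambda k) (beta k) (xs k) in
  (forall phi, extraction phi ->
     exists psi (y : 'M[R]_(p, 2)),
       extraction psi /\ (fun k => ys (phi (psi k))) @ \oo --> y) /\
  (forall phi (y : 'M[R]_(p, 2)), extraction phi ->
     (fun k => ys (phi k)) @ \oo --> y -> C_stationary f G H C x y).
Proof.
move=> ys; split=> [phi phi_extr|phi y phi_extr y_cvg].
  (* A bound on the whole sequence bounds each subsequence, from which a convergent one is
     extracted. *)
  have [M ysM] := multiplier_bounded f_smooth G_smooth H_smooth C_closed
    lambda_gt0 beta_01 beta_limsup dist_cvg xs_cvg x_D x_BCCQ.
  exact: bolzano_weierstrass_mx (fun k => ysM (phi k)).
(* The unscaled case: [tau] is constantly 1, so the limiting relation keeps the full gradient of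
   [f]. *)
have y_cvg1 : (fun k => (1 : R) *: ys (phi k)) @ \oo --> y.
  by under eq_fun do rewrite scale1r.
have [[v Nv v_sum] y_cones] := limit_multiplier f_smooth G_smooth
  H_smooth C_closed lambda_gt0 beta_01 beta_limsup dist_cvg xs_cvg x_D
  (extraction_cvg_infty phi_extr) (fun=> ler01) (cvg_cst (1 : R)) y_cvg1.
split; last by move=> i; have [] := y_cones i.
by exists v => //; move: v_sum; rewrite scale1r.
Qed.
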